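(* Let $\Gamma$ be a finite graph. Simple connectedness is an elementary property of $\Gamma$-spaces: there is a set $\Sigma$ of first-order sentences, in the language of graphs expanded by unary predicates $\mathcal{A}_\gamma$ ($\gamma\in\Gamma$) for the colours, such that a $\Gamma$-space $M$ is simply connected if and only if $M\models\Sigma$.
   Context: Graphs have a symmetric irreflexive edge relation. $\Gamma$ is a finite graph, whose elements are called colours. A $\Gamma$-graph $M$ is a graph whose vertex set is partitioned into colour classes $\mathcal{A}_\gamma(M)$, $\gamma\in\Gamma$, with no edges between elements of $\mathcal{A}_\gamma(M)$ and $\mathcal{A}_\delta(M)$ if $\gamma$ and $\delta$ are not adjacent in $\Gamma$. A flag of $M$ is a subgraph $F=\{f_\gamma\}_{\gamma\in\Gamma}$ with $f_\gamma\in\mathcal{A}_\gamma(M)$ such that $\gamma\mapsto f_\gamma$ is a graph isomorphism from $\Gamma$ to $F$. A $\Gamma$-space is a $\Gamma$-graph in which every vertex belongs to a flag and any two adjacent vertices belong to a common flag. A letter is a non-empty connected subset of $\Gamma$; a word is a finite sequence of letters. Two letters $s,t$ commute if $s\cup t$ is not a letter. A word $s_1\cdots s_n$ is reduced if there is no pair $i\neq j$ such that $s_i\subset s_j$ (equality allowed) and $s_i$ commutes with all letters of the word occurring between $s_i$ and $s_j$. A splitting of a letter $s$ is a (possibly trivial) word all of whose letters are properly contained in $s$. A weak flag path from the flag $F$ to the flag $G$ with word $s_1\cdots s_n$ is a sequence of flags $F=F_0,\ldots,F_n=G$ such that for each $i$ the set of colours at which $F_{i-1}$ and $F_i$ differ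 is exactly the letter $s_i$. It is a flag path if moreover for no $i$ there is a weak flag path in $M$ from $F_{i-1}$ to $F_i$ whose word is a splitting of $s_i$. A flag path is reduced if its word is reduced. The $\Gamma$-space $M$ is simply connected if there are no non-trivial closed reduced flag paths in $M$ (i.e. no reduced flag path of length $n\geq 1$ from a flag to itself). *)

(* Defs.v *)
From mathcomp Require Import all_boot.

Set Implicit Arguments.
Unset Strict Implicit.
Unset Printing Implicit Defensive.

(* First-order formulas with equality in the language {Edge} U {A_c : c : C},
   with free variables in X.  A quantifier binds the variable [None] of
   [option X].  Sentences have no free variable at all, so that satisfaction of
   a sentence needs no valuation and is also meaningful in the empty
   structure. *)
Inductive formula (C : Type) (X : Type) : Type :=
| FBot
| FEq of X & X
| FEdge of X & X
| FColour of C & X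
| FAnd of formula C X & formula C X
| FOr of formula C X & formula C X
| FImp of formula C X & formula C X
| FAll of formula C (option X)
| FEx of formula C (option X).

Definition sentence (C : Type) := formula C void.

Record structure (C : Type) := Structure {
  vertex :> Type;
  edge : vertex -> vertex -> Prop;
  class : C -> vertex -> Prop
}.

Definition push (V X : Type) (v : V) (e : X -> V) : option X -> V :=
  fun o => if o is Some x then e x else v.

Fixpoint sat (C : Type) (M : structure C) (X : Type) (phi : formula C X) :
    (X -> M) -> Prop :=
  match phi with
  | FBot => fun _ => False
  | FEq x y => fun e => e x = e y
  | FEdge x y => fun e => edge (e x) (e y)
  | FColour c x => fun e => class c (e x)
  | FAnd p q => fun e => sat p e /\ sat q e
  | FOr p q => fun e => sat p e \/ sat q e
  | FImp p q => fun e => sat p e -> sat q e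
  | FAll p => fun e => forall v : M, sat p (push v e)
  | FEx p => fun e => exists v : M, sat p (push v e)
  end.

Definition models (C : Type) (M : structure C) (Sigma : sentence C -> Prop) :=
  forall phi : sentence C, Sigma phi -> sat phi (@of_void M).

Section GammaSpaces.

Variables (Gamma : finType) (adj : rel Gamma).

(* Taking c = d in the last clause, there are no edges inside a colour class,
   because [adj] is irreflexive. *)
Record gamma_graph (M : structure Gamma) : Prop := GammaGraph {
  edge_sym : forall x y : M, edge x y -> edge y x;
  edge_irr : forall x : M, ~ edge x x;
  class_partition : forall x : M, exists! c, class c x;
  edge_class : forall (c d : Gamma) (x y : M),
    class c x -> class d y -> edge x y -> adj c d
}.

Section Flags.

Variable M : structure Gamma.

(* Since the colour classes are disjoint, F is automatically injective, and a
   flag as a subgraph is the same thing as its enumeration by colours. *)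
Definition is_flag (F : {ffun Gamma -> M}) : Prop :=
  (forall c, class c (F c)) /\ (forall c d, edge (F c) (F d) <-> adj c d).

Definition gamma_space : Prop :=
  [/\ gamma_graph M,
      forall x : M, exists2 F, is_flag F & exists c, F c = x
    & forall x y : M, edge x y ->
        exists2 F, is_flag F & (exists c, F c = x) /\ (exists d, F d = y)].

End Flags.

(* Connectedness refers to the subgraph of Gamma induced on s. *)
Definition letter (s : {set Gamma}) : bool :=
  (s != set0) &&
  [forall x in s, forall y in s,
     connect [rel a b | [&& a \in s, b \in s & adj a b]] x y].

Definition commute (s t : {set Gamma}) : bool := ~~ letter (s :|: t).

Definition word (w : seq {set Gamma}) : bool := all letter w.

(* The indices i and j may occur in either order. *)
Definition reduced (w : seq {set Gamma}) : Prop :=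
  ~ exists i j, [/\ i < size w, j < size w, i != j,
      nth set0 w i \subset nth set0 w j
    & forall k, minn i j < k < maxn i j ->
        commute (nth set0 w i) (nth set0 w k)].

Definition splitting (s : {set Gamma}) (u : seq {set Gamma}) : bool :=
  word u && all (fun t : {set Gamma} => t \proper s) u.

Section Paths.

Variable M : structure Gamma.
Implicit Types F G H : {ffun Gamma -> M}.

Definition weak_step F (s : {set Gamma}) G : Prop :=
  [/\ is_flag F, is_flag G, letter s & forall c, c \in s <-> F c <> G c].

Fixpoint chain
    (step : {ffun Gamma -> M} -> {set Gamma} -> {ffun Gamma -> M} -> Prop)
    F (w : seq {set Gamma}) G : Prop :=
  if w is s :: w' then exists2 H, step F s H & chain step H w' G else F = G.

Definition weak_flag_path F (w : seq {set Gamma}) G : Prop :=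
  is_flag F /\ chain weak_step F w G.

Definition step F (s : {set Gamma}) G : Prop :=
  weak_step F s G /\ ~ exists2 u, splitting s u & weak_flag_path F u G.

Definition flag_path F (w : seq {set Gamma}) G : Prop :=
  is_flag F /\ chain step F w G.

Definition simply_connected : Prop :=
  forall F w, flag_path F w F -> reduced w -> w = [::].

End Paths.

End GammaSpaces.

(* Main.v *)
From mathcomp Require Import all_boot.
From Stdlib Require Import Classical FunctionalExtensionality.
Require Import Defs.

Set Implicit Arguments.
Unset Strict Implicit.
Unset Printing Implicit Defensive.

(** The condition that a step does not split quantifies over splittings of
    arbitrary length, so the definition of simple connectedness is not first-order
    as it stands.  Replacing it by the condition that a weak step has no splitting
    of length at most [N] ([long_step]) gives a first-order condition for each [N],
    and the theorem amounts to the following uniform bound: in a simply connected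
    space, no closed path with reduced word [w <> [::]] consists of long steps for
    [N = size w * #|Gamma|].  So the sentences excluding such paths, for all
    reduced non-empty [w], axiomatise simple connectedness ([simply_connectedE]).

    The bound follows from a stronger statement, proved by induction on the length
    of [w]: for this [N], a path of long steps with reduced word [w] moves every colour of every
    letter of [w] ([long_path_moves]).  Suppose that a colour [c] of a letter returns
    to its value.  Let [s] be a maximal letter of [w] containing [c], at its first
    occurrence.  The two ends of that step are also joined the other way round,
    along the rest of [w] and one change of the colours other than [c].  Reducing
    this detour to a reduced flag path, while remembering which part of it comes from
    which letter, gives one block for each part.  In a simply connected space a
    reduced flag path between flags agreeing outside [s] uses only letters inside [s]
    ([simply_connected_within]), so every block is inside [s].  If no block moves all
    colours of [s], each can be rewritten as at most [#|Gamma|] changes of proper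
    connected subsets of [s], and together they split the step, with at most
    [size w * #|Gamma|] letters; so the step was not long.

    That no block covers [s] is clear for the blocks whose label does not contain
    [s].  A label containing [s] is a further occurrence of [s]; since [w] is reduced
    and by the induction hypothesis, the path up to it has moved a colour outside [s]
    adjacent to [s].  Thus a letter not commuting with [s] stands before the block,
    and as reduction only ever deletes letters that commute with all later ones
    ([evolve]), it can have disappeared only if the block no longer covers [s]
    ([screened]). *)

(** * Splitting sequences *)

Lemma nth_cat3 (T : Type) (x0 : T) (A : seq T) (x : T) (B : seq T) (y : T) (C : seq T) :
  [/\ nth x0 (A ++ x :: B ++ y :: C) (size A) = x,
      nth x0 (A ++ x :: B ++ y :: C) (size A + (size B).+1) = y
    & forall k, k < size B ->
        nth x0 (A ++ x :: B ++ y :: C) (size A + k.+1) = nth x0 B k].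
Proof.
split.
- by rewrite nth_cat ltnn subnn.
- by rewrite nth_cat ltnNge leq_addr /= addKn /= nth_cat ltnn subnn.
- by move=> k kB; rewrite nth_cat ltnNge leq_addr /= addKn /= nth_cat kB.
Qed.

Lemma split_at2 (T : Type) (x0 : T) (w : seq T) i j : i < j -> j < size w ->
  exists A B C, [/\ size A = i, size A + (size B).+1 = j &
    w = A ++ nth x0 w i :: B ++ nth x0 w j :: C].
Proof.
move=> ij jw; have iw := ltn_trans ij jw.
exists (take i w), (take (j - i.+1) (drop i.+1 w)), (drop j.+1 w).
rewrite !size_take size_drop iw.
have -> : j - i.+1 < size w - i.+1 by rewrite ltn_sub2r // (leq_ltn_trans ij).
split=> //; first by rewrite -addSnnS subnKC.
rewrite -{1}(cat_take_drop i w); congr (_ ++ _); rewrite (drop_nth x0) //; congr (_ :: _).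
rewrite -{1}(cat_take_drop (j - i.+1) (drop i.+1 w)); congr (_ ++ _).
by rewrite drop_drop subnK // (drop_nth x0).
Qed.

Lemma cat_eq_cons (T : Type) (V1 V2 A B : seq T) (x : T) : V1 ++ V2 = A ++ x :: B ->
  (exists2 A', A = V1 ++ A' & V2 = A' ++ x :: B) \/
  (exists2 B', V1 = A ++ x :: B' & B = B' ++ V2).
Proof.
elim: V1 A => [|v V1 IH] [|a A] /=.
- by move=> ->; left; exists [::].
- by move=> ->; left; exists (a :: A).
- by case=> -> <-; right; exists V1.
- case=> -> /IH[[A' -> ->]|[B' -> ->]]; first by left; exists A'.
  by right; exists B'.
Qed.

Lemma mem_split (T : eqType) (w : seq T) x : x \in w ->
  exists A B, w = A ++ x :: B /\ x \notin A.
Proof.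
elim: w => [//|y w IH]; rewrite inE; have [<- _|xy /= /IH[A [B [-> xA]]]] := eqVneq x y.
  by exists [::], w.
by exists (y :: A), B; rewrite inE negb_or xy.
Qed.

Lemma not_all_split (T : Type) (P : pred T) (w : seq T) : ~~ all P w ->
  exists A x B, [/\ w = A ++ x :: B, all P A & ~~ P x].
Proof.
elim: w => [//|y w IH] /=; case: (boolP (P y)) => [Py /IH[A [x [B [-> PA Px]]]]|Py _].
  by exists (y :: A), x, B; rewrite /= Py.
by exists [::], y, w.
Qed.

Lemma flatten_eq_cons (T : Type) (Bs : seq (seq T)) V1 (t : T) V2 :
  flatten Bs = V1 ++ t :: V2 -> exists A Y1 Y2 B,
  [/\ Bs = A ++ (Y1 ++ t :: Y2) :: B, V1 = flatten A ++ Y1 & V2 = Y2 ++ flatten B].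
Proof.
elim: Bs V1 => [|X Bs IH] V1 /= E; first by case: V1 E.
case: (cat_eq_cons E) => [[V1' -> /IH[A [Y1 [Y2 [B [-> -> ->]]]]]]|[Y2 -> ->]].
  by exists (X :: A), Y1, Y2, B; rewrite /= catA.
by exists [::], V1, Y2, Bs.
Qed.

(** * Letters and commutation *)

Section Letters.

Variables (Gamma : finType) (adj : rel Gamma).
Hypothesis adj_sym : symmetric adj.
Implicit Types (a b c d : Gamma) (s t u x y : {set Gamma}).

(** For letters, this is the negation of commuting ([commuteE]); unlike
    [~~ commute adj s t], it is monotone in both sets whatever they are. *)
Definition touch s t := [exists a in s, exists b in t, (a == b) || adj a b].

Lemma touchP s t :
  reflect (exists a b, [/\ a \in s, b \in t & a = b \/ adj a b]) (touch s t).
Proof.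
apply: (iffP exists_inP) => [[a sa /exists_inP[b tb ab]] | [a [b [sa tb ab]]]].
  by exists a, b; split=> //; case/orP: ab => [/eqP|]; [left | right].
exists a => //; apply/exists_inP; exists b => //.
by case: ab => [->|->]; rewrite ?eqxx ?orbT.
Qed.

Lemma touchC s t : touch s t = touch t s.
Proof.
by apply/touchP/touchP => -[a [b [sa tb ab]]]; exists b, a; split=> //;
  (case: ab => [->|]; [left | rewrite adj_sym; right]).
Qed.

Lemma touchSl s s' t : s \subset s' -> touch s t -> touch s' t.
Proof.
by move=> /subsetP ss' /touchP[a [b [sa tb ab]]]; apply/touchP; exists a, b; split; auto.
Qed.

(** Connectedness in the form in which it is used: no proper nonempty part
    of a letter is closed under adjacency. *)
Lemma letter_closed s (A : {set Gamma}) a :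
    letter adj s -> a \in s -> a \in A ->
    (forall c d, c \in s -> d \in s -> c \in A -> adj c d -> d \in A) ->
  s \subset A.
Proof.
case/andP=> _ /forall_inP conn sa Aa closedA.
apply/subsetP=> b sb; have /forall_inP/(_ b sb)/connectP[p] := conn a sa.
elim: p a sa Aa => [|c p IH] a sa Aa /=; first by move=> _ ->.
case/andP=> /and3P[_ sc ac]; apply: IH => //; exact: (closedA a).
Qed.

Lemma letter_neq0 s : letter adj s -> exists a, a \in s.
Proof. by case/andP=> /set0Pn. Qed.

Lemma letter1 a : letter adj [set a].
Proof.
apply/andP; split; first by apply/set0Pn; exists a; rewrite inE.
by apply/forall_inP=> b /set1P->; apply/forall_inP=> c /set1P->; apply: connect0.
Qed.

Lemma letterU s t : letter adj s -> letter adj t -> letter adj (s :|: t) = touch s t.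
Proof.
move=> ls lt; have [a sa] := letter_neq0 ls; have [b tb] := letter_neq0 lt.
apply/idP/idP=> [lst | /touchP[c [d [sc td cd]]]].
  apply: contraT => Nst; have Nst_ c d : c \in s -> d \in t -> ~ (c = d \/ adj c d).
    by move=> sc td cd; case/touchP: Nst; exists c, d.
  suff /subsetP/(_ b) : s :|: t \subset s.
    by rewrite inE tb orbT => /(_ isT) sb; case: (Nst_ b b) => //; left.
  apply: (letter_closed lst (a := a)); rewrite ?inE ?sa // => e f _.
  rewrite inE => /orP[//|tf] se ef; case: (Nst_ e f) => //; by right.
pose r (X : {set Gamma}) := [rel a b | [&& a \in X, b \in X & adj a b]].
have rS (X Y : {set Gamma}) e f : X \subset Y -> connect (r X) e f -> connect (r Y) e f.
  move=> /subsetP XY; apply: connect_sub => e' f' /and3P[Xe Xf ef].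
  by apply: connect1; rewrite /= !XY.
have rsym X : connect_sym (r X).
  by apply: sym_connect_sym => e f /=; rewrite andbCA adj_sym.
apply/andP; split; first by apply/set0Pn; exists a; rewrite inE sa.
have toc e : e \in s :|: t -> connect (r (s :|: t)) c e.
  rewrite inE => /orP[se|te].
    apply: rS (subsetUl s t) _.
    by have/andP[_ /forall_inP/(_ c sc)/forall_inP] := ls; apply.
  apply: (connect_trans (y := d)).
    case: cd => [->|cd]; first exact: connect0.
    by apply: connect1; rewrite /= !inE sc td orbT.
  apply: rS (subsetUr s t) _.
  by have/andP[_ /forall_inP/(_ d td)/forall_inP] := lt; apply.
apply/forall_inP=> e ste; apply/forall_inP=> f stf.
by apply: connect_trans (toc f stf); rewrite rsym; apply: toc.
Qed.

Lemma commuteE s t : letter adj s -> letter adj t -> commute adj s t = ~~ touch s t.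
Proof. by move=> ls lt; rewrite /commute letterU. Qed.

Lemma commuteC s t : commute adj s t = commute adj t s.
Proof. by rewrite /commute setUC. Qed.

Lemma commuteS s s' t : letter adj s -> letter adj s' -> letter adj t ->
  s \subset s' -> commute adj s' t -> commute adj s t.
Proof.
by move=> ls ls' lt ss'; rewrite !commuteE //; apply: contra; apply: touchSl.
Qed.

Lemma touch_exit s t : letter adj s -> letter adj t -> touch t s ->
  ~~ (t \subset s) -> exists e d, [/\ e \in t, e \notin s, d \in s & adj e d].
Proof.
move=> ls lt /touchP[a [b [ta sb ab]]] Nts.
have [sa|Nsa] := boolP (a \in s); last first.
  by case: ab => [ab|ab]; [case/negP: Nsa; rewrite ab | exists a, b].
apply: NNPP => Nex; case/negP: Nts; apply: (letter_closed lt ta sa) => c d tc td sc cd.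
by apply: contraT => Nsd; case: Nex; exists d, c; split=> //; rewrite adj_sym.
Qed.

(** A maximal letter inside [D] will do: any adjacent colour of [D] could be
    added to it. *)
Lemma component (D : {set Gamma}) : D != set0 ->
  exists K, [/\ letter adj K, K \subset D & forall a b, a \in K -> b \in D ->
    adj a b -> b \in K].
Proof.
case/set0Pn=> a Da.
have [|K /maxsetP[/andP[lK KD] maxK] _] :=
  @maxset_exists _ [pred K | letter adj K & K \subset D] [set a].
  by rewrite /= letter1 sub1set.
exists K; split=> // c d Kc Dd cd.
have <- : K :|: [set d] = K; last by rewrite !inE eqxx orbT.
apply: maxK; rewrite ?subsetUl //= subUset KD sub1set Dd letterU ?letter1 //= andbT.
by apply/touchP; exists c, d; rewrite inE; split=> //; right.
Qed.

(** * Reduced words *)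

(** The negation of [reduced], with the two positions given by a decomposition
    of the word, which suits concatenation and deletion better than indices. *)
Definition clash (w : seq {set Gamma}) : Prop :=
  exists A x B y C, w = A ++ x :: B ++ y :: C /\
    ((x \subset y /\ all (commute adj x) B) \/ (y \subset x /\ all (commute adj y) B)).

Lemma reducedE w : reduced adj w <-> ~ clash w.
Proof.
split=> [Rw [A [x [B [y [C [wE cl]]]]]] | Nw [i [j [iw jw ij sub com]]]].
- apply: Rw; have [xE yE BE] := nth_cat3 set0 A x B y C.
  rewrite -wE in xE yE BE.
  have ltij : size A < size A + (size B).+1 by rewrite -{1}[size A]addn0 ltn_add2l.
  have jw : size A + (size B).+1 < size w.
    by rewrite wE size_cat /= size_cat /= ltn_add2l ltnS addnS ltnS leq_addr.
  have iw := ltn_trans ltij jw.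
  have between z : all (commute adj z) B -> forall k,
    size A < k < size A + (size B).+1 -> commute adj z (nth set0 w k).
    move=> /(all_nthP set0) zB k /andP[Ak kB].
    have [m kE] : exists m, k = size A + m.+1.
      by exists (k - (size A).+1); rewrite -addSnnS subnKC.
    by move: kB; rewrite kE ltn_add2l ltnS => mB; rewrite BE ?zB.
  case: cl => -[sub com].
    exists (size A), (size A + (size B).+1); split; rewrite ?xE ?yE ?neq_ltn ?ltij //.
    by rewrite (minn_idPl (ltnW ltij)) (maxn_idPr (ltnW ltij)); apply: between.
  exists (size A + (size B).+1), (size A); split; rewrite ?xE ?yE ?neq_ltn ?ltij ?orbT //.
  by rewrite (minn_idPr (ltnW ltij)) (maxn_idPl (ltnW ltij)); apply: between.
- have mid i' j' z : i' < j' -> j' < size w ->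
      (forall k, i' < k < j' -> commute adj z (nth set0 w k)) ->
    exists A B C, w = A ++ nth set0 w i' :: B ++ nth set0 w j' :: C /\ all (commute adj z) B.
    move=> lt' jw' com'; have [A [B [C [Ai Bj wE]]]] := split_at2 set0 lt' jw'.
    exists A, B, C; split=> //; apply/(all_nthP set0)=> k kB.
    have [_ _ <- //] := nth_cat3 set0 A (nth set0 w i') B (nth set0 w j') C.
    by rewrite -wE; apply: com'; rewrite -Bj -Ai -{1}[size A]addn0 !ltn_add2l /= ltnS kB.
  apply: Nw; case: (ltngtP i j) ij com => // ltij _ com.
    have [|A [B [C [wE aB]]]] := mid i j (nth set0 w i) ltij jw.
      by move=> k kij; apply: com; rewrite ?(minn_idPl (ltnW ltij)) ?(maxn_idPr (ltnW ltij)).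
    by exists A, (nth set0 w i), B, (nth set0 w j), C; split=> //; left.
  have [|A [B [C [wE aB]]]] := mid j i (nth set0 w i) ltij iw.
    by move=> k kij; apply: com; rewrite ?(minn_idPr (ltnW ltij)) ?(maxn_idPl (ltnW ltij)).
  by exists A, (nth set0 w j), B, (nth set0 w i), C; split=> //; right.
Qed.

Lemma clash_catl A B : clash B -> clash (A ++ B).
Proof.
move=> [A' [x [B' [y [C [-> cl]]]]]]; exists (A ++ A'), x, B', y, C.
by rewrite catA.
Qed.

Lemma clash_catr A B : clash A -> clash (A ++ B).
Proof.
move=> [A' [x [B' [y [C [-> cl]]]]]]; exists A', x, B', y, (C ++ B); split=> //.
by rewrite -catA /= -catA.
Qed.

Lemma clash_rcons V (b : {set Gamma}) : clash (rcons V b) -> clash V \/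
  exists V1 t V2, V = V1 ++ t :: V2 /\
    ((t \subset b /\ all (commute adj t) V2) \/ (b \subset t /\ all (commute adj b) V2)).
Proof.
move=> [A [x [B [y [C [VE cl]]]]]]; case/lastP: C VE => [|C z] VE.
  move: VE; rewrite -cat_rcons cats1 -rcons_cat => /rcons_inj[-> ->].
  by right; exists A, x, B; rewrite cat_rcons.
left; exists A, x, B, y, C; split=> //.
by move: VE; rewrite -rcons_cons -rcons_cat -rcons_cons -rcons_cat => /rcons_inj[].
Qed.

Lemma word_cat V1 V2 : word adj (V1 ++ V2) = word adj V1 && word adj V2.
Proof. exact: all_cat. Qed.

(** Deleting a letter that commutes with all later ones cannot create a clash:
    a smaller letter that commutes with everything but the deleted letter has to
    commute with it too. *)
Lemma clash_delete V1 t V2 : word adj (V1 ++ t :: V2) -> all (commute adj t) V2 ->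
  clash (V1 ++ V2) -> clash (V1 ++ t :: V2).
Proof.
rewrite word_cat /= => /and3P[wV1 lt wV2] /allP tV2.
move=> [A [x [B [y [C [E cl]]]]]].
case: (cat_eq_cons E) => [[A' EA EV]|[B' EV /esym EB]].
  by rewrite -cat_rcons; apply: clash_catl; exists A', x, B, y, C.
case: (cat_eq_cons EB) => [[B2 E2 EV2]|[C' EB' EC]]; last first.
  by apply: clash_catr; exists A, x, B, y, C'; rewrite EV EB'.
exists A, x, (B' ++ t :: B2), y, C; split; first by rewrite EV EV2 -!catA /= -?catA.
have lx : letter adj x by move: wV1; rewrite EV word_cat => /and3P[].
have ly : letter adj y by move: wV2; rewrite EV2 word_cat => /and3P[].
have ty : commute adj t y by apply: tV2; rewrite EV2 mem_cat inE eqxx orbT.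
move: cl; rewrite E2 !all_cat /= => -[[xy /andP[-> ->]]|[yx /andP[-> ->]]].
  by left; split=> //=; rewrite andbT; apply: commuteS xy _ => //; rewrite commuteC.
by right; split=> //=; rewrite andbT commuteC.
Qed.

End Letters.

(** * Paths of flags *)

Section Paths.

Variables (Gamma : finType) (adj : rel Gamma).
Hypothesis adj_sym : symmetric adj.
Variable M : structure Gamma.
Hypothesis MG : gamma_graph adj M.
Implicit Types (F G H K : {ffun Gamma -> M}) (s t u b : {set Gamma}).
Implicit Types (V W : seq {set Gamma}).

Local Notation wstep := (@weak_step Gamma adj M).
Local Notation gstep := (@step Gamma adj M).

Lemma chain_cat st F V1 V2 G :
  chain st F (V1 ++ V2) G <-> exists2 H, chain st F V1 H & chain st H V2 G.
Proof.
elim: V1 F => [|t V1 IH] F /=.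
  by split=> [c|[H -> //]]; exists F.
split=> [[H FH /IH[K HK KG]]|[K [H FH HK] KG]]; first by exists K => //; exists H.
by exists H => //; apply/IH; exists K.
Qed.

Lemma chain1 (st : {ffun Gamma -> M} -> {set Gamma} -> {ffun Gamma -> M} -> Prop) F t G :
  st F t G -> chain st F [:: t] G.
Proof. by exists G. Qed.

Lemma chain_rev st F V G : (forall F t G, st F t G -> st G t F) ->
  chain st F V G -> chain st G (rev V) F.
Proof.
move=> st_sym; elim: V F => [|t V IH] F /=; first by move->.
case=> H FH /IH HG; rewrite rev_cons -cats1; apply/chain_cat; exists H => //.
by apply: chain1; apply: st_sym.
Qed.

Lemma chain_impl (st st' : {ffun Gamma -> M} -> {set Gamma} -> {ffun Gamma -> M} -> Prop)
    F V G : (forall F t G, st F t G -> st' F t G) -> chain st F V G -> chain st' F V G.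
Proof.
move=> imp; elim: V F => [//|t V IH] F /= [H FH HG]; exists H; auto.
Qed.

Lemma weak_step_sym F s G : wstep F s G -> wstep G s F.
Proof. by case=> fF fG ls dif; split=> // c; rewrite dif; split=> ne E; apply: ne. Qed.

Lemma splitting_rev s V : splitting adj s V -> splitting adj s (rev V).
Proof. by rewrite /splitting /word !all_rev. Qed.

Lemma step_sym F s G : gstep F s G -> gstep G s F.
Proof.
case=> ws nosplit; split; first exact: weak_step_sym.
case=> V sV [_ GF]; apply: nosplit; exists (rev V); first exact: splitting_rev.
by split; [case: ws | apply: chain_rev GF; apply: weak_step_sym].
Qed.

Lemma step_weak F s G : gstep F s G -> wstep F s G.
Proof. by case. Qed.

Lemma chain_flag F V G : is_flag adj F -> chain wstep F V G -> is_flag adj G.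
Proof. by elim: V F => [|t V IH] F fF /=; [move<- | case=> H [_ fH _ _]; apply: IH]. Qed.

Lemma chain_word F V G : chain wstep F V G -> word adj V.
Proof.
by elim: V F => [//|t V IH] F /= [H [_ _ lt _]] /IH wV; rewrite /word /= lt.
Qed.

Lemma chain_stepW F V G : chain gstep F V G -> chain wstep F V G.
Proof. by apply: chain_impl => *; apply: step_weak. Qed.

Definition agree_off s F G := forall c, c \notin s -> F c = G c.

Definition within s V := all (fun t : {set Gamma} => t \subset s) V.

Definition strictly s V := all (fun t : {set Gamma} => t \proper s) V.

Lemma within_cat s V W : within s (V ++ W) = within s V && within s W.
Proof. exact: all_cat. Qed.

Lemma strictly_cat s V W : strictly s (V ++ W) = strictly s V && strictly s W.
Proof. exact: all_cat. Qed.

Lemma agree_off_sym s F G : agree_off s F G -> agree_off s G F.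
Proof. by move=> FG c /FG. Qed.

Lemma weak_step_agree F s G : wstep F s G -> agree_off s F G.
Proof. by case=> _ _ _ dif c Nsc; apply: NNPP => /dif; apply/negP. Qed.

Lemma chain_moved F V G c : chain wstep F V G -> F c <> G c ->
  exists2 t, t \in V & c \in t.
Proof.
elim: V F => [|t V IH] F /=; first by move->.
case=> H FH HG ne.
have [tc|Ntc] := boolP (c \in t); first by exists t; rewrite ?inE ?eqxx.
have [|t' Vt' t'c] := IH H HG; last by exists t'; rewrite ?inE ?Vt' ?orbT.
by rewrite -(weak_step_agree FH).
Qed.

Lemma chain_agree F V G s : chain wstep F V G -> within s V -> agree_off s F G.
Proof.
move=> FG /allP Vs c Nsc; apply: NNPP => /(chain_moved FG)[t /Vs/subsetP ts tc].
by rewrite ts in Nsc.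
Qed.

Lemma strictly_splitting F V G s : chain wstep F V G -> strictly s V ->
  splitting adj s V.
Proof. by move=> /chain_word wV sV; rewrite /splitting wV. Qed.

Lemma moved_set F G : exists D : {set Gamma}, forall c, c \in D <-> F c <> G c.
Proof.
have [|f fE] := @fin_all_exists Gamma (fun=> bool) (fun c (e : bool) => e <-> F c <> G c).
  by move=> c; case: (classic (F c = G c)) => FG; [exists false | exists true].
by exists [set c | f c] => c; rewrite inE.
Qed.

(** * Patching two flags *)

Definition patch u F G : {ffun Gamma -> M} := [ffun c => if c \in u then F c else G c].

(** Edges inside each part come from the two flags, and an edge of [Gamma] between
    the parts is realised since both flags have the same vertex at its end. *)
Lemma patch_flag u F G : is_flag adj F -> is_flag adj G ->
  (forall c d, c \in u -> d \notin u -> adj c d -> F d = G d) -> is_flag adj (patch u F G).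
Proof.
move=> [Fcl Fe] [Gcl Ge] glue; split=> [c|c d]; rewrite !ffunE; first by case: ifP.
have mixed a e : a \in u -> e \notin u -> edge (F a) (G e) <-> adj a e.
  move=> ua Nue; split=> [|ae]; first exact: (edge_class MG).
  by rewrite -(glue _ _ ua Nue ae); apply/Fe.
case: (boolP (c \in u)) => uc; case: (boolP (d \in u)) => ud //; first exact: mixed.
rewrite adj_sym; split=> [/(edge_sym MG)/mixed|dc]; first exact.
by apply: (edge_sym MG); apply/mixed.
Qed.

(** The connected components of the difference can be changed one after the other:
    there are no edges of [Gamma] between them, so the intermediate patches are
    flags. *)
Lemma agree_off_path (D : {set Gamma}) F G : is_flag adj F -> is_flag adj G ->
  agree_off D F G ->
  exists2 V, chain wstep F V G & within D V /\ size V <= #|D|.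
Proof.
have [n] := ubnP #|D|; elim: n D F => [//|n IH] D F ltD fF fG FG.
have [D' D'E] := moved_set F G.
have D'D : D' \subset D.
  by apply/subsetP=> c /D'E ne; apply: contraT => /FG.
have [D0|Dn0] := eqVneq D' set0.
  exists [::] => //; apply/ffunP=> c; apply: NNPP => /D'E; by rewrite D0 inE.
have [K [lK KD Kmax]] := component adj_sym Dn0.
have [a Ka] := letter_neq0 lK.
pose H := patch K G F.
have fH : is_flag adj H.
  apply: patch_flag => // c d Kc NKd cd; apply: NNPP => ne.
  have /(Kmax _ _ Kc)/(_ cd) : d \in D' by apply/D'E => E; apply: ne.
  by apply/negP.
have [||V HG [VD sV]] := IH (D' :\: K) H _ fH fG.
- rewrite -ltnS; apply: leq_trans ltD; rewrite ltnS.
  apply: leq_trans (subset_leq_card D'D); apply: proper_card.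
  by apply/properP; split; [exact: subsetDl | exists a; rewrite ?(subsetP KD) // inE Ka].
- move=> c; rewrite inE negb_and negbK ffunE; case: (boolP (c \in K)) => //= _ ND'c.
  by apply: NNPP => /D'E; apply/negP.
exists (K :: V).
  exists H => //; split=> // c; rewrite ffunE; split=> [Kc|].
    by rewrite Kc; apply/D'E/(subsetP KD).
  by case: ifP.
split=> /=.
  rewrite /within /= (subset_trans KD D'D) /=; apply: sub_all VD => t tD.
  by apply: (subset_trans tD); apply: subset_trans D'D; apply: subsetDl.
apply: leq_ltn_trans sV _; apply: leq_trans (subset_leq_card D'D).
apply: proper_card; apply/properP; split; first exact: subsetDl.
by exists a; rewrite ?(subsetP KD) // inE Ka.
Qed.

(** A weak step is a step or splits, and so on until all letters are genuine
    steps; this stops because the letters shrink. *)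
Lemma weak_step_refine F s G : wstep F s G ->
  exists2 V, chain gstep F V G & within s V.
Proof.
have [n] := ubnP #|s|; elim: n s F G => [//|n IH] s F G les FG.
have [[V /andP[_ sV] [_ {FG}]]|Nsplit] :=
  classic (exists2 V, splitting adj s V & weak_flag_path adj F V G); last first.
  by exists [:: s]; [apply: chain1 | rewrite /within /= subxx].
elim: V F sV => [|t V IHV] F /=; first by move=> _ ->; exists [::].
case/andP=> ts sV [H FH /(IHV _ sV)[V2 HG V2s]].
have [|V1 FH1 V1t] := IH t F H _ FH; first by apply: leq_trans (proper_card ts) _.
exists (V1 ++ V2); first by apply/chain_cat; exists H.
rewrite within_cat V2s andbT; apply: sub_all V1t => t' t't.
exact: subset_trans t't (proper_sub ts).
Qed.

Lemma weak_path_refine F W G s : chain wstep F W G -> within s W ->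
  exists2 V, chain gstep F V G & within s V.
Proof.
elim: W F => [|t W IH] F /=; first by move->; exists [::].
case=> H /weak_step_refine[V1 FH V1t] /IH{}IH /andP[ts /IH[V2 HG V2s]].
exists (V1 ++ V2); first by apply/chain_cat; exists H.
by rewrite within_cat V2s andbT; apply: sub_all V1t => t' /subset_trans; apply.
Qed.

Lemma agree_off_refine s F G : is_flag adj F -> is_flag adj G -> agree_off s F G ->
  exists2 V, chain gstep F V G & within s V.
Proof.
by move=> fF fG /(agree_off_path fF fG)[W FG [Ws _]]; apply: weak_path_refine FG Ws.
Qed.

(** * Commuting letters can be exchanged *)

(** Changes inside [u] do not see what happens in a part [t] of the flag that
    [u] does not touch. *)
Lemma transport t u F F' G V : ~~ touch adj t u -> agree_off t F G ->
    is_flag adj G -> chain wstep F V F' -> within u V ->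
  chain wstep G V (patch u F' G).
Proof.
move=> Ntu; have tu c d : c \in t -> d \in u -> ~ (c = d \/ adj c d).
  by move=> tc ud cd; case/touchP: Ntu; exists c, d.
elim: V F G => [|a V IH] F G FG fG /=.
  move=> <- _; apply/ffunP=> c; rewrite ffunE; case: ifP => // uc.
  by apply/esym/FG; apply/negP=> tc; apply: (tu c c) => //; left.
case=> F1 FF1 F1F' /andP[au Vu].
have [fF fF1 la dif] := FF1; have aoff := weak_step_agree FF1.
have FGu c : c \in u -> F c = G c.
  by move=> uc; apply: FG; apply/negP=> tc; apply: (tu c c) => //; left.
have fG1 : is_flag adj (patch u F1 G).
  apply: patch_flag => // c d uc Nud cd.
  rewrite -aoff; last by apply: contra Nud; apply: subsetP.
  by apply: FG; apply/negP=> td; apply: (tu d c) => //; right; rewrite adj_sym.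
exists (patch u F1 G).
  split=> // c; rewrite dif ffunE; case: ifP => [uc|Nuc]; first by rewrite FGu.
  rewrite aoff //; by apply: contraFN Nuc; apply: subsetP.
have -> : patch u F' G = patch u F' (patch u F1 G).
  by apply/ffunP=> c; rewrite !ffunE; case: ifP.
apply: IH F1F' Vu => // c Ntc; rewrite ffunE; case: ifP => // Nuc.
by rewrite -FG // aoff //; apply: contraFN Nuc; apply: subsetP.
Qed.

Lemma strictly_within s V : strictly s V -> within s V.
Proof. by apply: sub_all => t; apply: proper_sub. Qed.

(** The changes in [t] and in [u] can be made in either order, and by
    [transport] a splitting of either exchanged step would split the original. *)
Lemma swap_step F t G u H : commute adj t u -> gstep F t G -> gstep G u H ->
  exists2 G', gstep F u G' & gstep G' t H.
Proof.
move=> + FG GH; have [[fF fG lt dt] FGsplit] := FG; have [[_ fH lu du] GHsplit] := GH.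
rewrite commuteE // => Ntu.
have tu c d : c \in t -> d \in u -> ~ (c = d \/ adj c d).
  by move=> tc ud cd; case/touchP: Ntu; exists c, d.
have toff := weak_step_agree (step_weak FG); have uoff := weak_step_agree (step_weak GH).
have Ntc c : c \in u -> c \notin t.
  by move=> uc; apply/negP=> tc; apply: (tu c c) => //; left.
pose G' := patch u H F.
have fG' : is_flag adj G'.
  apply: patch_flag => // c d uc Nud cd; rewrite -uoff //; apply/esym/toff.
  by apply/negP=> td; apply: (tu d c) => //; right; rewrite adj_sym.
have FG'u : wstep F u G'.
  split=> // c; rewrite ffunE; case: ifP => [uc|Nuc] //.
  by rewrite toff ?Ntc // -du uc.
have G'Ht : wstep G' t H.
  split=> // c; rewrite ffunE dt; case: (boolP (c \in u)) => [uc|Nuc].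
    by rewrite toff ?Ntc.
  by rewrite -uoff.
exists G'; split=> // -[V sV [_ path]]; have /andP[wV /strictly_within Vin] := sV.
- apply: GHsplit; exists V => //; split=> //.
  have := transport Ntu toff fG path Vin; congr (chain _ _ _ _).
  by apply/ffunP=> c; rewrite !ffunE; case: (boolP (c \in u)) => [//|Nuc]; rewrite uoff.
- apply: FGsplit; exists V => //; split=> //.
  have Nut : ~~ touch adj u t by rewrite touchC.
  have := transport Nut (agree_off_sym (weak_step_agree FG'u)) fF path Vin.
  congr (chain _ _ _ _).
  apply/ffunP=> c; rewrite !ffunE; case: (boolP (c \in t)) => [tc|Ntc']; last by rewrite toff.
  by rewrite uoff //; apply: contraL tc; apply: Ntc.
Qed.

Lemma swap_right F t G V H : all (commute adj t) V ->
  gstep F t G -> chain gstep G V H ->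
  exists2 G', chain gstep F V G' & gstep G' t H.
Proof.
elim: V F G => [|u V IH] F G /=; first by move=> _ FG <-; exists F.
case/andP=> tu tV FG [K GK KH]; have [G1 FG1 G1K] := swap_step tu FG GK.
by have [G' G1G' G'H] := IH G1 K tV G1K KH; exists G' => //; exists G1.
Qed.

Lemma swap_left F t G V H : all (commute adj t) V ->
  chain gstep F V G -> gstep G t H ->
  exists2 G', gstep F t G' & chain gstep G' V H.
Proof.
elim: V F => [|u V IH] F /=; first by move=> _ <- FH; exists H.
case/andP=> tu tV [K FK KG] GH; have [K' KK' K'H] := IH K tV KG GH.
have [|G' FG' G'K'] := swap_step _ FK KK'; first by rewrite commuteC.
by exists G' => //; exists K'.
Qed.

(** A change strictly inside [t] is invisible next to a step with letter [t]:
    a splitting of the combined change would split the step itself. *)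
Lemma step_absorb F t G b H : gstep F t G -> wstep G b H -> b \proper t ->
  gstep F t H.
Proof.
move=> [[fF fG lt dt] nosplit] GH bt; have [_ fH lb db] := GH.
have [D DE] := moved_set F H.
have FtH : agree_off t F H.
  move=> c Ntc; rewrite -(weak_step_agree GH).
    by apply: NNPP => /dt; apply/negP.
  by apply: contra Ntc; apply: (subsetP (proper_sub bt)).
have bad V : splitting adj t V -> chain wstep F V H -> False.
  move=> /andP[wV sV] FH; apply: nosplit; exists (V ++ [:: b]).
    by rewrite /splitting word_cat wV all_cat sV /= lb bt.
  by split=> //; apply/chain_cat; exists H => //; apply: chain1; apply: weak_step_sym.
have Dt : D \subset t.
  by apply/subsetP=> c /DE ne; apply: contraT => /FtH.
have DtE : D = t.
  apply/eqP; apply: contraT => Dne.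
  have [|V FH [VD _]] := agree_off_path (D := D) fF fH.
    by move=> c NDc; apply: NNPP => /DE; apply/negP.
  case: (bad V) => //; apply: (strictly_splitting FH); apply: sub_all VD => t' t'D.
  by apply: sub_proper_trans t'D _; rewrite properEneq Dne.
split; first by split=> // c; rewrite -DtE DE.
by case=> V sV [_ FH]; apply: bad FH.
Qed.

Lemma absorb_step F b G t H : wstep F b G -> gstep G t H -> b \proper t ->
  gstep F t H.
Proof.
move=> FG GH bt; apply: step_sym; apply: step_absorb bt; first exact: step_sym GH.
exact: weak_step_sym.
Qed.

(** If the total change is all of [b], it is a step or splits; otherwise its
    connected components are properly inside [b]. *)
Lemma step_repeat F b G H : gstep F b G -> gstep G b H ->
  gstep F b H \/ exists2 V, chain gstep F V H & strictly b V.
Proof.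
move=> FG GH; have [[fF fG lb db] _] := FG; have [[_ fH _ db'] _] := GH.
have [D DE] := moved_set F H.
have DFH : agree_off D F H by move=> c NDc; apply: NNPP => /DE; apply/negP.
have Db : D \subset b.
  apply/subsetP=> c /DE ne; apply: contraT => Nbc; case: ne.
  by rewrite (weak_step_agree (step_weak FG)) // (weak_step_agree (step_weak GH)).
have smaller W : chain wstep F W H -> strictly b W ->
    exists2 V, chain gstep F V H & strictly b V.
  elim: W F {FG fF db DE DFH} => [|t W IH] F /=; first by move=> -> _; exists [::].
  case=> K /weak_step_refine[V1 FK V1t] /IH{}IH /andP[tb /IH[V2 KH V2b]].
  exists (V1 ++ V2); first by apply/chain_cat; exists K.
  rewrite strictly_cat V2b andbT; apply: sub_all V1t => t' t't.
  exact: sub_proper_trans t't tb.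
have [DbE|Dne] := eqVneq D b.
  have FHb : wstep F b H by split=> // c; rewrite -DbE DE.
  have [[V /andP[_ sV] [_ FH]]|] :=
    classic (exists2 V, splitting adj b V & weak_flag_path adj F V H).
    by right; apply: smaller sV.
  by left.
right; have [W FH [WD _]] := agree_off_path fF fH DFH.
apply: smaller FH _; apply: sub_all WD => t tD.
by apply: sub_proper_trans tD _; rewrite properEneq Dne.
Qed.

(** * Reducing a flag path *)

(** [evolve s V W] records what can happen to the reduced word [V] when a path
    with letters inside [s] is appended and the result [W] reduced again.  Only what
    is needed to trace letters of [V] is kept: a deleted letter commutes with
    everything after it, and new letters arrive at the end. *)
Inductive evolve s : seq {set Gamma} -> seq {set Gamma} -> Prop :=
| evolve_refl V : evolve s V V
| evolve_delete V1 t V2 W : t \subset s -> all (commute adj t) V2 ->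
    evolve s (V1 ++ V2) W -> evolve s (V1 ++ t :: V2) W
| evolve_append V t W : letter adj t -> t \subset s ->
    evolve s (V ++ [:: t]) W -> evolve s V W.

Lemma evolve_trans s V1 V2 V3 : evolve s V1 V2 -> evolve s V2 V3 -> evolve s V1 V3.
Proof.
move=> e12; elim: e12 V3 => // [A t B W ts tB _ IH|V t W lt ts _ IH] V3 /IH.
  exact: evolve_delete.
exact: evolve_append.
Qed.

Lemma evolveS b s V W : b \subset s -> evolve b V W -> evolve s V W.
Proof.
move=> bs; elim=> [*|A t B W' tb tB _ IH|V' t W' lt tb _ IH]; first exact: evolve_refl.
  exact: evolve_delete (subset_trans tb bs) tB IH.
exact: evolve_append lt (subset_trans tb bs) IH.
Qed.

Lemma evolve_keep s V W p : evolve s V W -> p \in V -> ~~ (p \subset s) -> p \in W.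
Proof.
elim=> [//|A t B W' ts _ _ IH|V' t W' _ ts _ IH] + Nps; last first.
  by move=> V'p; apply: IH => //; rewrite mem_cat V'p.
rewrite mem_cat inE => pin; apply: IH => //; move: pin; rewrite mem_cat.
by have [pt|] := eqVneq p t; first by rewrite pt ts in Nps.
Qed.

(** Naming this property of [b] makes it usable for the smaller letters inside the
    induction that proves it. *)
Definition appendable b := forall V F G H,
  chain gstep F V G -> ~ clash adj V -> gstep G b H ->
  exists W, [/\ chain gstep F W H, ~ clash adj W & evolve b V W].

Lemma append_appendable s X V F G H :
    (forall b, b \in X -> b \subset s /\ appendable b) ->
    chain gstep F V G -> ~ clash adj V -> chain gstep G X H ->
  exists W, [/\ chain gstep F W H, ~ clash adj W & evolve s V W].
Proof.
elim: X V G => [|b X IH] V G ok FG NV /=.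
  by move=> <-; exists V; split=> //; apply: evolve_refl.
case=> K GK KH; have [bs app] := ok b (mem_head _ _).
have [W1 [FK NW1 VW1]] := app _ _ _ _ FG NV GK.
have [|W [FH NW W1W]] := IH _ _ _ FK NW1 KH.
  by move=> b' Xb'; apply: ok; rewrite inE Xb' orbT.
by exists W; split=> //; apply: evolve_trans W1W; apply: evolveS VW1.
Qed.

(** If the new letter [b] produces a clash, it is absorbed by a larger letter,
    or absorbs a smaller one, or meets its twin and possibly dissolves into
    smaller letters, which are appended in turn. *)
Lemma append_step b : appendable b.
Proof.
have [n] := ubnP #|b|; elim: n b => [//|n IHn] b leb V F G H.
have [m] := ubnP (size V); elim: m V F G H => [//|m IHm] V F G H ltV FG NV GH.
have [cl|Ncl] := classic (clash adj (rcons V b)); last first.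
  exists (rcons V b); split=> //; last first.
    have [[_ _ lb _] _] := GH; apply: (evolve_append lb (subxx b)).
    by rewrite cats1; apply: evolve_refl.
  by rewrite -cats1; apply/chain_cat; exists G => //; apply: chain1.
case: (clash_rcons cl) => // -[V1 [t [V2 [VE tb]]]].
have /chain_cat[F1 FF1 [F2 F12 F2G]] : chain gstep F (V1 ++ t :: V2) G by rewrite -VE.
have wV := chain_word (chain_stepW FG).
have unchanged : chain gstep F V H ->
    exists W, [/\ chain gstep F W H, ~ clash adj W & evolve b V W].
  by move=> FH; exists V; split=> //; apply: evolve_refl.
(* If [t] is not inside [b], then [b] is a proper part of [t]: move it next to [t]. *)
have [Etb|Ntb] := boolP (t \subset b); last first.
  case: tb => [[tb]|[bt com]]; first by rewrite tb in Ntb.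
  have [F3 F23 F3H] := swap_left com F2G GH.
  apply: unchanged; rewrite VE; apply/chain_cat; exists F1 => //; exists F3 => //.
  by apply: step_absorb F12 (step_weak F23) _; rewrite properE bt.
have com : all (commute adj t) V2.
  by case: tb => [[]|[bt]] //; have -> : t = b by apply/eqP; rewrite eqEsubset Etb.
have NV12 : ~ clash adj (V1 ++ V2).
  by move=> cl'; apply: NV; rewrite VE; apply: clash_delete => //; rewrite -VE.
have [G' F1G' G'G] := swap_right com F12 F2G.
have FG' : chain gstep F (V1 ++ V2) G' by apply/chain_cat; exists F1.
(* From here [t] moves to the end, next to [b]; either [b] swallows it, or [t = b]. *)
have [Et|Nt] := eqVneq t b; last first.
  have tb' : t \proper b by rewrite properEneq Nt.
  have [|W [FH NW ev]] := IHm _ _ _ _ _ FG' NV12 (absorb_step (step_weak G'G) GH tb').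
    by rewrite -ltnS; apply: leq_trans ltV; rewrite VE !size_cat /= addnS ltnS.
  by exists W; split=> //; rewrite VE; apply: evolve_delete.
rewrite {}Et in F12 F2G VE Etb com G'G {tb}.
have [G'H|[X G'H Xb]] := step_repeat G'G GH.
  have [F3 F13 F3H] := swap_left com F1G' G'H.
  by apply: unchanged; rewrite VE; apply/chain_cat; exists F1 => //; exists F3.
have [|W [FH NW ev]] := append_appendable (s := b) _ FG' NV12 G'H.
  move=> b' Xb'; have b'b := allP Xb _ Xb'; split; first exact: proper_sub.
  by apply: IHn; apply: leq_trans (proper_card b'b) _.
by exists W; split=> //; rewrite VE; apply: evolve_delete.
Qed.

Lemma append_path s X V F G H : within s X ->
    chain gstep F V G -> ~ clash adj V -> chain gstep G X H ->
  exists W, [/\ chain gstep F W H, ~ clash adj W & evolve s V W].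
Proof.
move=> Xs; apply: append_appendable => b Xb.
by split; [apply: (allP Xs) | apply: append_step].
Qed.

(** The letters outside [s] survive closing the path inside [s]; so there are
    none in a simply connected space. *)
Lemma simply_connected_within s V F G : simply_connected adj M ->
    is_flag adj F -> is_flag adj G ->
    chain gstep F V G -> ~ clash adj V -> agree_off s F G ->
  within s V.
Proof.
move=> sc fF fG FG NV /agree_off_sym agr.
have [X GF Xs] := agree_off_refine fG fF agr.
have [W [FF NW ev]] := append_path Xs FG NV GF.
have W0 : W = [::] by apply: (sc F) => //; apply/reducedE.
apply/allP=> p Vp; apply: contraT => Nps.
by have := evolve_keep ev Vp Nps; rewrite W0.
Qed.

(** * Reducing a labelled path block by block *)

Definition covered s V := forall c, c \in s -> exists2 t, t \in V & c \in t.

Definition blocking s (p : {set Gamma}) := ~~ (p \subset s) && ~~ commute adj p s.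

(** A block that covers [s] has a letter before it that prevents it from being
    moved to the front.  Once all letters are inside [s], nothing is blocking, so no
    block covers [s]. *)
Definition screened s (Bs : seq (seq {set Gamma})) := forall A X B,
  Bs = A ++ X :: B -> covered s X -> exists2 p, p \in flatten A & blocking s p.

Lemma covered_commute s t X : letter adj s -> letter adj t -> word adj X ->
  covered s X -> all (commute adj t) X -> commute adj t s.
Proof.
move=> ls lt wX cov /allP com; rewrite commuteE //; apply/touchP=> -[a [c [ta sc ac]]].
have [x Xx xc] := cov c sc; have := com x Xx.
rewrite commuteE //; last exact: (allP wX).
by case/touchP; exists a, c.
Qed.

(** A blocking letter can only be deleted while it commutes with all later
    letters, and then the later blocks do not cover [s]. *)
Lemma screened_delete s A Y1 t Y2 B : letter adj s ->
    word adj (flatten (A ++ (Y1 ++ t :: Y2) :: B)) ->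
    all (commute adj t) (Y2 ++ flatten B) ->
  screened s (A ++ (Y1 ++ t :: Y2) :: B) -> screened s (A ++ (Y1 ++ Y2) :: B).
Proof.
move=> ls; rewrite flatten_cat /= word_cat word_cat word_cat /=.
move=> /and3P[_ /and3P[_ lt _] wB] /[!all_cat] /andP[_ tB] scr A' X' B' E cov.
case: (cat_eq_cons E) => [[[|Z C] A'E /= [XE BE]]|[C AE BE]].
- rewrite cats0 in A'E; rewrite A'E; apply: (scr A (Y1 ++ t :: Y2) B) => // c /cov[u].
  rewrite -XE mem_cat => Yu uc; exists u => //; rewrite mem_cat inE.
  by case/orP: Yu => ->; rewrite ?orbT.
- have [|p + bp] := scr (A ++ (Y1 ++ t :: Y2) :: C) X' B' _ cov.
    by rewrite BE -catA.
  rewrite flatten_cat mem_cat /= !mem_cat inE => pin.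
  suff Npt : p != t.
    exists p => //; rewrite A'E flatten_cat mem_cat /= -XE !mem_cat.
    by rewrite (negPf Npt) in pin.
  apply: contraTneq bp => ->; rewrite /blocking negb_and !negbK.
  move: wB tB; rewrite BE flatten_cat /= !word_cat !all_cat => /and3P[_ wX _] /and3P[_ tX _].
  by rewrite (covered_commute ls lt wX cov tX) orbT.
- by apply: (scr A' X' (C ++ (Y1 ++ t :: Y2) :: B)) => //; rewrite AE -catA.
Qed.

(** Letters appended to a word of blocks go to a new last block [X]; the screening
    of the old blocks persists. *)
Lemma evolve_blocks s l V W Bs X : letter adj s -> evolve l V W ->
    word adj V -> V = flatten Bs ++ X -> within l X -> screened s Bs ->
  exists Bs' X', [/\ W = flatten Bs' ++ X', within l X', size Bs' = size Bs & screened s Bs'].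
Proof.
move=> ls ev; elim: ev Bs X => {V W}
  [V|V1 t V2 W tl com ev IH|V t W lt tl ev IH] Bs X wV VE Xl scr.
- by exists Bs, X.
- have wV12 : word adj (V1 ++ V2) by move: wV; rewrite !word_cat /= => /and3P[-> _ ->].
  case: (cat_eq_cons (esym VE)) => [[X' V1E XE]|[Y BsE V2E]].
    apply: (IH Bs (X' ++ V2)) => //; first by rewrite V1E catA.
    by move: Xl; rewrite XE !within_cat /= => /and3P[-> _ ->].
  case: (flatten_eq_cons BsE) => A [Y1 [Y2 [B [BsE' V1E YE]]]].
  have [||Bs' [X' [WE X'l sz scr']]] := IH (A ++ (Y1 ++ Y2) :: B) X wV12 _ Xl.
  + by rewrite V1E V2E YE flatten_cat /= -!catA.
  + apply: (screened_delete (t := t)); rewrite -?BsE' //.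
      by move: wV; rewrite VE word_cat => /andP[].
    by move: com; rewrite V2E YE all_cat => /andP[].
  by exists Bs', X'; split=> //; rewrite sz BsE' !size_cat.
- apply: (IH Bs (X ++ [:: t])) => //; first by rewrite word_cat wV /= lt.
    by rewrite VE catA.
  by rewrite within_cat Xl /within /= tl.
Qed.

(** * Going round a closed path *)

(** The detour of [long_path_moves], with [n] labels, as a sequence of moves that need not
    be steps.  The side condition on labels containing [s] provides the blocking letter
    required by [screened]: the path up to that move has to pass a letter
    containing [e], and such a letter is not inside [s] and does not commute with
    it. *)
Inductive itinerary s F : nat -> {ffun Gamma -> M} -> Prop :=
| itinerary0 : itinerary s F 0 F
| itineraryS n G H l : itinerary s F n G -> is_flag adj H -> agree_off l G H ->
    (s \subset l -> l = s /\
       exists e d, [/\ F e <> G e, e \notin s, d \in s & adj e d]) ->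
  itinerary s F n.+1 H.

Lemma itinerary_blocks s F n G : letter adj s -> is_flag adj F -> itinerary s F n G ->
  exists Bs, [/\ size Bs = n, chain gstep F (flatten Bs) G,
                ~ clash adj (flatten Bs) & screened s Bs].
Proof.
move=> ls fF; elim=> {n G} [|n G H l _ [Bs [sz FG NV scr]] fH GH blk].
  by exists [::]; split=> //; [move=> [[|? ?] [? [? [? [? []]]]]] | case].
have fG := chain_flag fF (chain_stepW FG).
have [X GXH Xl] := agree_off_refine fG fH GH.
have [W [FH NW ev]] := append_path Xl FG NV GXH.
have wV := chain_word (chain_stepW FG).
have [|Bs' [X' [WE X'l sz' scr']]] := evolve_blocks ls ev wV _ (X := [::]) isT scr.
  by rewrite cats0.
have flE : flatten (rcons Bs' X') = W by rewrite WE flatten_rcons.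
exists (rcons Bs' X'); split; rewrite ?size_rcons ?sz' ?sz ?flE //.
move=> A Y B; rewrite -cats1 => E cov; case: (cat_eq_cons E) => [[A' AE XE]|[C BsE _]].
  case: A' XE AE => [|? [|? ?]] // [YE _] AE; rewrite cats0 in AE.
  have sl : s \subset l.
    apply/subsetP=> c /cov[t]; rewrite -YE => /(allP X'l)/subsetP; exact.
  have [lE [e [d [Fe Nse sd ed]]]] := blk sl.
  have [p Vp pe] := chain_moved (chain_stepW FG) Fe.
  have Nps : ~~ (p \subset s) by apply: contra Nse => /subsetP; apply.
  exists p.
    have := evolve_keep ev Vp; rewrite lE => /(_ Nps); rewrite WE mem_cat AE => /orP[//|].
    by move=> /(allP X'l); rewrite lE (negPf Nps).
  have lp : letter adj p by apply: (allP wV).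
  rewrite /blocking Nps commuteE // negbK; apply/touchP.
  by exists e, d; split=> //; right.
exact: scr' BsE cov.
Qed.

(** A path inside [s] that leaves one colour of [s] fixed can be replaced by the
    components of its total change, which are proper parts of [s]. *)
Lemma uncovered_path s F X G : letter adj s -> is_flag adj F -> chain gstep F X G ->
    within s X -> ~ covered s X ->
  exists2 V, chain wstep F V G & strictly s V /\ size V <= #|Gamma|.
Proof.
move=> ls fF FG Xs Ncov; have fG := chain_flag fF (chain_stepW FG).
have [c [sc Nc]] : exists c, c \in s /\ forall t, t \in X -> c \notin t.
  apply: NNPP => No; apply: Ncov => c sc; apply: NNPP => Nt; apply: No.
  by exists c; split=> // t Xt; apply/negP=> tc; apply: Nt; exists t.
have [|V FVG [VD sz]] := agree_off_path (D := s :\ c) fF fG.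
  apply: chain_agree (chain_stepW FG) _; apply/allP=> t Xt.
  by rewrite subsetD1 (allP Xs) // Nc.
exists V => //; split; last exact: leq_trans sz (max_card _).
by apply: sub_all VD => t tD; apply: sub_proper_trans tD (properD1 sc).
Qed.

Lemma uncovered_blocks_path s F Bs G : letter adj s -> is_flag adj F ->
    chain gstep F (flatten Bs) G -> within s (flatten Bs) ->
    (forall X, X \in Bs -> ~ covered s X) ->
  exists2 V, chain wstep F V G & strictly s V /\ size V <= size Bs * #|Gamma|.
Proof.
move=> ls; elim: Bs F => [|X Bs IH] F fF /=; first by move=> -> _ _; exists [::].
case/chain_cat=> H FH HG; rewrite within_cat => /andP[Xs Bss] Ncov.
have [V1 FV1 [V1s sz1]] := uncovered_path ls fF FH Xs (Ncov X (mem_head _ _)).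
have [|V2 HV2 [V2s sz2]] := IH H (chain_flag fF (chain_stepW FH)) HG Bss.
  by move=> Y BsY; apply: Ncov; rewrite inE BsY orbT.
exists (V1 ++ V2); first by apply/chain_cat; exists H.
by rewrite strictly_cat V1s V2s size_cat mulSn leq_add.
Qed.

Lemma itinerary_short s F n G : simply_connected adj M -> letter adj s ->
    is_flag adj F -> itinerary s F n G -> agree_off s F G ->
  exists2 V, chain wstep F V G & strictly s V /\ size V <= n * #|Gamma|.
Proof.
move=> sc ls fF it FG; have [Bs [<- path NW scr]] := itinerary_blocks ls fF it.
have fG := chain_flag fF (chain_stepW path).
have Bss := simply_connected_within sc fF fG path NW FG.
apply: (uncovered_blocks_path ls fF path Bss) => X /mem_split[A [B [BsE _]]] cov.
have [p Ap /andP[Nps _]] := scr A X B BsE cov.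
case/negP: Nps; apply: (allP Bss); rewrite BsE flatten_cat mem_cat Ap //.
Qed.

(** The first-order approximation of [step]. *)
Definition long_step N F s G := wstep F s G /\
  ~ exists2 V, size V <= N & splitting adj s V /\ weak_flag_path adj F V G.

Lemma step_long N F s G : gstep F s G -> long_step N F s G.
Proof. by case=> ws Nsplit; split=> // -[V _ [sV path]]; apply: Nsplit; exists V. Qed.

Lemma long_step_weak N F s G : long_step N F s G -> wstep F s G.
Proof. by case. Qed.

Lemma chain_longW N F w G : chain (long_step N) F w G -> chain wstep F w G.
Proof. by apply: chain_impl => F' t G' /long_step_weak. Qed.

Lemma itinerary_extend N s F n G A H : itinerary s F n G -> chain (long_step N) G A H ->
  (forall l, l \in A -> ~~ (s \subset l)) -> itinerary s F (n + size A) H.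
Proof.
elim: A n G => [|l A IH] n G it /=; first by move=> <- _; rewrite addn0.
case=> K /long_step_weak GK KH Nsl; rewrite -addSnnS; apply: IH KH _; last first.
  by move=> l' Al'; apply: Nsl; rewrite inE Al' orbT.
have [_ fK _ _] := GK; apply: itineraryS it fK (weak_step_agree GK) _ => sl.
by have := Nsl l (mem_head _ _); rewrite sl.
Qed.

(** The uniform bound, in the form that can be proved by induction; applied to a
    closed path it says that the word is empty. *)
Lemma long_path_moves N : simply_connected adj M -> forall w F G,
    chain (long_step N) F w G -> ~ clash adj w -> size w * #|Gamma| <= N ->
  forall t c, t \in w -> c \in t -> F c <> G c.
Proof.
move=> sc w; have [n] := ubnP (size w); elim: n w => [//|n IHn] w ltw F G FG Nw szN.
move=> t0 c wt0 t0c FGc.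
have [|s /maxsetP[/andP[ws sc'] smax] _] :=
  @maxset_exists _ [pred x | x \in w & c \in x] t0; first by rewrite /= wt0.
have {}smax l : l \in w -> s \subset l -> l = s.
  by move=> wl sl; apply: smax => //=; rewrite wl (subsetP sl).
have [A [B [wE NsA]]] := mem_split ws.
have /chain_cat[Fa FA [Fb FaFb FbG]] : chain (long_step N) F (A ++ s :: B) G by rewrite -wE.
have [[fFa fFb ls sdif] Nsplit] := FaFb.
have fG := chain_flag fFb (chain_longW FbG).
have wB := chain_word (chain_longW FbG).
(* Maximality of [s] leaves only [l = s] to be examined; as [w] is reduced, some
   letter [k] between the two occurrences of [s] does not commute with [s] and is not
   inside it, and the induction hypothesis applies to the path between them. *)
have along B1 B2 K : B = B1 ++ B2 -> chain (long_step N) Fb B1 K ->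
    itinerary s Fb (size B1) K.
  elim/last_ind: B1 B2 K => [|B1 l IHB] B2 K BE /=; first by move=> <-; apply: itinerary0.
  rewrite size_rcons -cats1 => /chain_cat[K' path [K2 K'K <-]].
  have [_ fK _ _] := long_step_weak K'K.
  apply: itineraryS (IHB (l :: B2) K' _ path) fK _ _.
  - by rewrite -cat_rcons.
  - exact: weak_step_agree (long_step_weak K'K).
  move=> sl; have lE : l = s.
    by apply: smax sl; rewrite wE BE mem_cat !inE mem_cat mem_rcons mem_head !orbT.
  split=> //; rewrite {}lE in K'K BE sl.
  have {}BE : B = B1 ++ s :: B2 by rewrite BE cat_rcons.
  have [com|] := boolP (all (commute adj s) B1).
    case: Nw; exists A, s, B1, s, B2; rewrite wE BE; split=> //.
    by left; split=> //; apply: subxx.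
  case/not_all_split=> C [k [D [B1E comC Nsk]]].
  have wB1 : word adj B1 by move: wB; rewrite BE word_cat => /andP[].
  have /and3P[wC lk _] : [&& word adj C, letter adj k & word adj D].
    by move: wB1; rewrite B1E word_cat.
  have Nks : ~~ (k \subset s).
    apply/negP=> ks; apply: Nw; exists A, s, C, k, (D ++ s :: B2).
    rewrite wE BE B1E -catA; split=> //; right; split=> //.
    apply/allP=> x Cx; apply: commuteS ks (allP comC x Cx) => //.
    exact: (allP wC).
  move: Nsk; rewrite commuteE // negbK touchC // => tks.
  have [e [d [ke Nse sd ed]]] := touch_exit adj_sym ls lk tks Nks.
  exists e, d; split=> //; apply: (IHn B1 _ _ _ path _ _ k) => //.
  - rewrite -ltnS; apply: leq_trans ltw; rewrite wE BE !size_cat /= size_cat.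
    by rewrite ltnS; apply: leq_trans (leq_addl _ _); rewrite ltnS leq_addr.
  - move=> cl; apply: Nw; rewrite wE BE; apply: clash_catl.
    by rewrite -cat_cons; apply: clash_catr; rewrite -cat1s; apply: clash_catl.
  - apply: leq_trans szN; rewrite leq_mul2r wE BE !size_cat /= size_cat.
    by apply/orP; right; apply: leq_trans (leq_addl _ _); apply: leqW; apply: leq_addr.
  - by rewrite B1E mem_cat mem_head orbT.
have it1 := along B [::] G (esym (cats0 B)) FbG.
have fF : is_flag adj F.
  by case: A FA {NsA wE} => [/= -> //|l A [K /long_step_weak[]]].
(* The way back from [G] to [F]: everything but [c] may change. *)
have it2 : itinerary s Fb (size B).+1 F.
  apply: (itineraryS (l := [set~ c])) it1 fF _ _.
    by move=> a; rewrite !inE negbK => /eqP->.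
  by move=> /subsetP/(_ c sc'); rewrite !inE eqxx.
(* No label before the first occurrence of [s] contains [s]. *)
have it3 : itinerary s Fb ((size B).+1 + size A) Fa.
  apply: itinerary_extend it2 FA _ => l Al; apply: contra NsA => sl.
  by rewrite -(smax l) // wE mem_cat Al.
have ag : agree_off s Fb Fa := agree_off_sym (weak_step_agree (long_step_weak FaFb)).
have [V path [Vs sz]] := itinerary_short sc ls fFb it3 ag.
apply: Nsplit; exists (rev V).
  rewrite size_rev; apply: leq_trans sz _; apply: leq_trans szN.
  by rewrite wE size_cat /= addnC.
split; first exact: splitting_rev (strictly_splitting path Vs).
by split=> //; apply: chain_rev path; apply: weak_step_sym.
Qed.

Lemma simply_connectedE : simply_connected adj M <->
  forall w, reduced adj w -> w <> [::] ->
    ~ exists F, is_flag adj F /\ chain (long_step (size w * #|Gamma|)) F w F.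
Proof.
split=> [sc w Rw w0 [F [fF FF]] | long F w [fF FF] Rw].
  case: w w0 Rw FF => // t w _ Rw FF; have [H /long_step_weak[_ _ lt _] _] := FF.
  have [c tc] := letter_neq0 lt; have /reducedE Nc := Rw.
  exact: (long_path_moves sc FF Nc (leqnn _) (mem_head _ _) tc).
apply: NNPP => w0; case: (long w Rw w0); exists F; split=> //.
by apply: chain_impl FF => *; apply: step_long.
Qed.

End Paths.

(** * Definable properties of flags *)

Section Definability.

Variable C : Type.

Fixpoint rename (X : Type) (phi : formula C X) : forall Y, (X -> Y) -> formula C Y :=
  match phi with
  | FBot => fun Y _ => FBot C Y
  | FEq x y => fun Y f => FEq C (f x) (f y)
  | FEdge x y => fun Y f => FEdge C (f x) (f y)
  | FColour c x => fun Y f => FColour c (f x)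
  | FAnd p q => fun Y f => FAnd (rename p f) (rename q f)
  | FOr p q => fun Y f => FOr (rename p f) (rename q f)
  | FImp p q => fun Y f => FImp (rename p f) (rename q f)
  | FAll p => fun Y f => FAll (rename p (omap f))
  | FEx p => fun Y f => FEx (rename p (omap f))
  end.

Lemma push_omap (V X Y : Type) (f : X -> Y) (e : Y -> V) v :
  push v e \o omap f = push v (e \o f).
Proof. by apply: functional_extensionality => -[]. Qed.

Lemma sat_rename (M : structure C) X (phi : formula C X) Y (f : X -> Y) (e : Y -> M) :
  sat (rename phi f) e <-> sat phi (e \o f).
Proof.
elim: {X} phi Y f e => //= [X p IHp q IHq|X p IHp q IHq|X p IHp q IHq|X p IH|X p IH] Y f e.
- by rewrite IHp IHq.
- by rewrite IHp IHq.
- by rewrite IHp IHq.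
- by split=> H v; have := H v; rewrite IH push_omap.
- by split=> -[v H]; exists v; move: H; rewrite IH push_omap.
Qed.

Definition extend (V X : Type) n (e : X -> V) (f : 'I_n -> V) (z : X + 'I_n) : V :=
  match z with inl x => e x | inr i => f i end.

(** Quantification over a finite tuple of vertices, without leaving the
    nested variables [option X] of the syntax. *)
Lemma sat_ex_block n X (phi : formula C (X + 'I_n)) :
  exists psi : formula C X, forall (M : structure C) (e : X -> M),
    sat psi e <-> exists f : 'I_n -> M, sat phi (extend e f).
Proof.
elim: n X phi => [|n IH] X phi.
  have g0 (z : X + 'I_0) : X by case: z => // -[].
  exists (rename phi (fun z => if z is inl x then x else g0 z)) => M e.
  rewrite sat_rename.
  have f0 : 'I_0 -> M by case.
  have E (f : 'I_0 -> M) : e \o (fun z => if z is inl x then x else g0 z) = extend e f.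
    by apply: functional_extensionality => -[x|[]].
  by split=> [H|[f]]; [exists f0; rewrite -E | rewrite -E].
pose g (z : X + 'I_n.+1) : option X + 'I_n := match z with
  | inl x => inl (Some x)
  | inr i => if unlift ord0 i is Some j then inr j else inl None
  end.
have [psi psiE] := IH (option X) (rename phi g).
exists (FEx psi) => M e /=; split=> [[v /psiE[f]]|[f H]].
  rewrite sat_rename => H.
  exists (fun i => if unlift ord0 i is Some j then f j else v).
  move: H; congr (sat _ _); apply: functional_extensionality => -[x|i] //=.
  by case: (unlift ord0 i).
exists (f ord0); apply/psiE; exists (f \o lift ord0); rewrite sat_rename.
move: H; congr (sat _ _); apply: functional_extensionality => -[x|i] //=.
by case: unliftP => [j ->|->].
Qed.

End Definability.

Section DefinableFlags.

Variables (Gamma : finType) (adj : rel Gamma).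

(** A property of flags indexed by [K]; a flag is a tuple of vertices, so that it
    is expressed by a formula with free variables in [K * Gamma]. *)
Definition flag_property (K : Type) :=
  forall M : structure Gamma, (K -> {ffun Gamma -> M}) -> Prop.

Definition definable K (R : flag_property K) :=
  exists phi : formula Gamma (K * Gamma),
    forall (M : structure Gamma) (e : K -> {ffun Gamma -> M}),
    sat phi (fun p => e p.1 p.2) <-> R M e.

Lemma definable_ext K (R R' : flag_property K) :
  (forall M e, R M e <-> R' M e) -> definable R -> definable R'.
Proof. by move=> RR' [phi phiE]; exists phi => M e; rewrite phiE. Qed.

Lemma definable_and K (R R' : flag_property K) : definable R -> definable R' ->
  definable (fun M e => R M e /\ R' M e).
Proof. by move=> [p pE] [q qE]; exists (FAnd p q) => M e /=; rewrite pE qE. Qed.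

Lemma definable_not K (R : flag_property K) : definable R ->
  definable (fun M e => ~ R M e).
Proof. by move=> [p pE]; exists (FImp p (FBot _ _)) => M e /=; rewrite pE. Qed.

Lemma definable_const K (P : Prop) :
  definable (fun (M : structure Gamma) (_ : K -> {ffun Gamma -> M}) => P).
Proof.
case: (classic P) => HP; last by exists (FBot _ _) => M e; split.
by exists (FImp (FBot _ _) (FBot _ _)) => M e; split=> // _ [].
Qed.

Lemma definable_forall K (T : finType) (R : T -> flag_property K) :
  (forall t, definable (R t)) -> definable (fun M e => forall t, R t M e).
Proof.
move=> defR.
suff: definable (fun M e => forall t, t \in enum T -> R t M e).
  apply: definable_ext => M e; split=> H t; last by move=> _; apply: H.
  by apply: H; rewrite mem_enum.
elim: (enum T) => [|t s IH].
  by apply: definable_ext (definable_const K True) => M e; split.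
apply: definable_ext (definable_and (defR t) IH) => M e; split=> [[Rt Rs] t'|H].
  by rewrite inE => /orP[/eqP->|/Rs].
by split=> [|t' st']; apply: H; rewrite inE ?eqxx ?st' ?orbT.
Qed.

Lemma definable_exists K (T : finType) (R : T -> flag_property K) :
  (forall t, definable (R t)) -> definable (fun M e => exists t, R t M e).
Proof.
move=> defR; apply: definable_ext (definable_not (definable_forall
  (fun t => definable_not (defR t)))) => M e.
split=> [H|[t Rt] H]; last exact: H Rt.
by apply: NNPP => N; apply: H => t Rt; apply: N; exists t.
Qed.

Lemma definable_ex_flag K (R : flag_property (option K)) : definable R ->
  definable (fun M e => exists F, R M (push F e)).
Proof.
move=> [phi phiE].
pose g (p : option K * Gamma) : K * Gamma + 'I_#|Gamma| :=
  if p.1 is Some k then inl (k, p.2) else inr (enum_rank p.2).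
have [psi psiE] := sat_ex_block (rename phi g).
exists psi => M e; rewrite psiE; split=> [[f]|[F /phiE H]].
  rewrite sat_rename => H; exists [ffun c => f (enum_rank c)]; apply/phiE.
  move: H; congr (sat _ _); apply: functional_extensionality => -[[k|] c] //=.
  by rewrite ffunE.
exists (F \o enum_val); rewrite sat_rename.
move: H; congr (sat _ _); apply: functional_extensionality => -[[k|] c] //=.
by rewrite enum_rankK.
Qed.

Lemma definable_flag K (k : K) : definable (fun M e => is_flag adj (e k)).
Proof.
apply: definable_and.
  by apply: definable_forall => c; exists (FColour c (k, c)) => M e.
apply: definable_forall => c; apply: definable_forall => d.
have defE : definable (fun (M : structure Gamma) (e : K -> {ffun Gamma -> M}) =>
    edge (e k c) (e k d)).
  by exists (FEdge _ (k, c) (k, d)).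
have [cd|Ncd] := boolP (adj c d).
  by apply: definable_ext defE => M e; split=> [H|[_ H]]; [split | apply: H].
by apply: definable_ext (definable_not defE) => M e; split=> [N|[N _] /N].
Qed.

Lemma definable_weak_step K (k l : K) s :
  definable (fun M e => weak_step adj (e k) s (e l)).
Proof.
have defE : definable (fun (M : structure Gamma) (e : K -> {ffun Gamma -> M}) =>
    forall c, c \in s <-> e k c <> e l c).
  apply: definable_forall => c.
  have defE : definable (fun (M : structure Gamma) (e : K -> {ffun Gamma -> M}) =>
      e k c = e l c).
    by exists (FEq _ (k, c) (l, c)).
  have [sc|Nsc] := boolP (c \in s).
    by apply: definable_ext (definable_not defE) => M e; split=> [H|[H _]]; [split | apply: H].
  apply: definable_ext defE => M e; split=> [->|[_ H]]; first by split.
  by apply: NNPP => /H.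
apply: definable_ext (definable_and (definable_and (definable_flag k) (definable_flag l))
  (definable_and (definable_const K (letter adj s)) defE)) => M e.
by split=> [[[? ?] []]|[]].
Qed.

(** The word is fixed, so the intermediate flags can be quantified one by one. *)
Lemma definable_chain
    (st : forall M : structure Gamma,
       {ffun Gamma -> M} -> {set Gamma} -> {ffun Gamma -> M} -> Prop) K (k l : K) w :
    (forall K (k l : K) s, definable (fun M e => st M (e k) s (e l))) ->
  definable (fun M e => chain (st M) (e k) w (e l)).
Proof.
move=> defst; elim: w K k l => [|s w IH] K k l /=.
  apply: (@definable_ext _ (fun M e => forall c, e k c = e l c)).
    by move=> M e; split=> [H|-> //]; apply/ffunP.
  by apply: definable_forall => c; exists (FEq _ (k, c) (l, c)).
have := definable_ex_flag (definable_and (defst _ (Some k) None s) (IH _ None (Some l))).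
by apply: definable_ext => M e; split=> [[H []]|[H]]; exists H.
Qed.

Lemma definable_long_step N K (k l : K) s :
  definable (fun M e => long_step adj N (e k) s (e l)).
Proof.
apply: definable_and; first exact: definable_weak_step.
apply: definable_not.
apply: (@definable_ext _ (fun M e => exists n : 'I_N.+1, exists V : n.-tuple {set Gamma},
    splitting adj s V /\ (is_flag adj (e k) /\ chain (@weak_step _ adj M) (e k) V (e l)))).
  move=> M e; split=> [[n [V sV]]|[V szV sV]].
    by exists V => //; rewrite size_tuple -ltnS.
  by have lt : size V < N.+1 by []; exists (Ordinal lt), (in_tuple V).
apply: definable_exists => n; apply: definable_exists => V.
apply: definable_and; first exact: definable_const.
apply: definable_and; first exact: definable_flag.
apply: definable_chain => *; exact: definable_weak_step.
Qed.

(** Over the empty index type [void] the formula has no free variable, so it is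
    a sentence after renaming. *)
Lemma closed_path_sentence N w : exists phi : sentence Gamma, forall M : structure Gamma,
  sat phi (@of_void M) <->
  ~ exists F : {ffun Gamma -> M}, is_flag adj F /\ chain (@long_step _ adj M N) F w F.
Proof.
have [phi phiE] := definable_not (definable_ex_flag (definable_and
  (definable_flag (None : option void))
  (definable_chain (st := fun M => @long_step _ adj M N) None None w
    (fun K => @definable_long_step N K)))).
exists (rename phi (fun p => p.1)) => M; rewrite sat_rename -(phiE M (of_void _)).
by split; congr (sat _ _); apply: functional_extensionality => -[[]].
Qed.

End DefinableFlags.

Theorem theoremA (Gamma : finType) (adj : rel Gamma)
    (adj_sym : symmetric adj) (adj_irr : irreflexive adj) :
  exists Sigma : sentence Gamma -> Prop,
    forall M : structure Gamma, gamma_space adj M ->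
      (simply_connected adj M <-> models M Sigma).
Proof.
exists (fun phi => exists w, [/\ reduced adj w, w <> [::] & forall M : structure Gamma,
  sat phi (@of_void M) <-> ~ exists F : {ffun Gamma -> M},
    is_flag adj F /\ chain (@long_step _ adj M (size w * #|Gamma|)) F w F]).
move=> M [MG _ _]; rewrite (simply_connectedE adj_sym MG).
split=> [sc phi [w [Rw w0 ->]]|sat_all w Rw w0]; first exact: sc.
have [phi phiE] := closed_path_sentence adj (size w * #|Gamma|) w.
by apply/phiE; apply: sat_all; exists w.
Qed.
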